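(* Let $X$ be a regular connected graph and $S$ a nonempty set of marked vertices with walk-equitable neighborhoods in $X\setminus S$. The following are equivalent: (i) $\widehat M[S,S]$ is symmetric; (ii) $\widehat M[S,S]$ is positive semidefinite; (iii) $S$ is degree-separating in $X\setminus S$.
   Context: $X$ is $k$-regular. Walk: arcs are ordered pairs $(u,v)$ of adjacent vertices; $R$ the arc-reversal matrix; $D_t$ the tail incidence matrix ($(D_t)_{x,(u,v)}=1$ iff $x=u$); $O_S$ the identity with $[S,S]$ block zeroed; $U=R(\frac2kD_t^TO_SD_t-I)$. Average vertex mixing matrix: $\widehat M_{u,v}=\lim_{T\to\infty}\frac1T\sum_{t=0}^{T-1}\sum_{w\sim u}|(U^tx_v)_{(u,w)}|^2$, $x_v=k^{-1/2}D_t^Te_v$. $S$ has walk-equitable neighborhoods in $X\setminus S$ if for every $m\ge0$ and all $a,b\in S$, the number of walks of length $m$ in $X\setminus S$ from a vertex $u\in N(a)\setminus S$ to $N(b)\setminus S$ is independent of the choice of $u\in N(a)\setminus S$. For a subgraph $Y$ of $X$, a vertex set $T$ is degree-separating in $Y$ if for any $u,v\in T$ with $|N(u)\cap V(Y)|\neq|N(v)\cap V(Y)|$, no vertex of $N(u)\cap V(Y)$ lies in the same connected component of $Y$ as any vertex of $N(v)\cap V(Y)$. *)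

(* Defs.v *)
From HB Require Import structures.
From mathcomp Require Import all_boot all_order all_algebra.
From mathcomp Require Import classical_sets reals topology normedtype sequences.
Import Order.TTheory GRing.Theory Num.Theory.
Import numFieldNormedType.Exports.

Set Implicit Arguments.
Unset Strict Implicit.
Unset Printing Implicit Defensive.

Local Open Scope ring_scope.

Section Graphs.
Variables (V : finType) (e : rel V).

Definition simple_graph : Prop := symmetric e /\ irreflexive e.

Definition connected_graph : Prop := forall x y : V, connect e x y.

Definition nbhd (x : V) : {set V} := [set y | e x y].

Definition regular_graph (k : nat) : Prop := forall x : V, #|nbhd x| = k.

Definition induced (W : {set V}) : rel V :=
  [rel x y | [&& x \in W, y \in W & e x y]].

Definition num_walks (f : rel V) (m : nat) (u : V) (B : {set V}) : nat :=
  #|[set p : m.-tuple V | path f u p && (last u p \in B)]|.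

Definition walk_equitable_nbhds (S : {set V}) : Prop :=
  forall (m : nat) (a b : V), a \in S -> b \in S ->
  forall u u' : V, u \in nbhd a :\: S -> u' \in nbhd a :\: S ->
    num_walks (induced (~: S)) m u (nbhd b :\: S) =
    num_walks (induced (~: S)) m u' (nbhd b :\: S).

(* The subgraph Y is given by its vertex set W and its adjacency relation f;
   neighbourhoods are taken in the whole graph, components in Y. *)
Definition degree_separating (W : {set V}) (f : rel V) (T : {set V}) : Prop :=
  forall u v : V, u \in T -> v \in T ->
    #|nbhd u :&: W| <> #|nbhd v :&: W| ->
  forall x y : V, x \in nbhd u :&: W -> y \in nbhd v :&: W ->
    ~~ connect f x y.

Definition arc := {a : V * V | e a.1 a.2}.

Definition arc_tail (a : arc) : V := (val a).1.
Definition arc_head (a : arc) : V := (val a).2.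

End Graphs.

(* Rows and columns of the matrices below are indexed through enum_rank and
   enum_val, i.e. by the fixed enumerations of the vertices and of the arcs. *)
Section Walk.
Variables (R : realType) (V : finType) (e : rel V) (k : nat) (S : {set V}).

Local Notation arc := (arc e).

Definition arc_reversal : 'M[R]_#|{: arc}| :=
  \matrix_(i, j) ((arc_tail (enum_val i) == arc_head (enum_val j)) &&
                  (arc_head (enum_val i) == arc_tail (enum_val j)))%:R.

Definition tail_incidence : 'M[R]_(#|V|, #|{: arc}|) :=
  \matrix_(i, j) (enum_val i == arc_tail (enum_val j))%:R.

Definition marked_oracle : 'M[R]_#|V| :=
  \matrix_(i, j) if ((enum_val i : V) \in S) && ((enum_val j : V) \in S)
                 then 0 else (i == j)%:R.

Definition transition : 'M[R]_#|{: arc}| :=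
  arc_reversal *m ((2%:R / k%:R) *:
    (tail_incidence^T *m marked_oracle *m tail_incidence) - 1%:M).

Definition start_state (v : V) : 'cV[R]_#|{: arc}| :=
  (Num.sqrt k%:R)^-1 *: (tail_incidence^T *m delta_mx (enum_rank v) 0).

(* The sum over w ~ u is written as a sum over the arcs with tail u. *)
Definition vertex_mixing (t : nat) (u v : V) : R :=
  \sum_(a : arc | arc_tail a == u)
     `|(transition ^+ t *m start_state v) (enum_rank a) 0| ^+ 2.

Definition avg_vertex_mixing : 'M[R]_#|V| :=
  \matrix_(i, j) limn (fun T : nat =>
    T%:R^-1 * \sum_(0 <= t < T) vertex_mixing t (enum_val i) (enum_val j)).

End Walk.

Definition principal_submx (R : realType) (V : finType) (S : {set V})
    (M : 'M[R]_#|V|) : 'M[R]_#|S| :=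
  mxsub (fun i : 'I_#|S| => enum_rank (enum_val i : V))
        (fun i : 'I_#|S| => enum_rank (enum_val i : V)) M.

Definition positive_semidefinite (R : realType) (n : nat) (M : 'M[R]_n) : Prop :=
  M \is symmetricmx /\ forall x : 'cV[R]_n, 0 <= (x^T *m M *m x) 0 0.

(* Main.v *)
(* A vertex mixing entry inside S splits into a part living on the arcs inside
   S, where U only reverses arcs and changes sign, and a part
   q_t(u,v)^2 / d_u, where d_u = |N(u) \ S|, q_t(u,v) = <y_u, U^t y_v> and y_v
   is the indicator of the arcs from v to the complement of S: walk-equitable
   neighbourhoods make U^t y_v constant on the arcs supporting y_u, because its
   amplitudes are Chebyshev polynomials of the adjacency operator of X \ S.
   Averaging, M_uv = (delta_uv (k - d_u) + A_uv) / (2k) + K_uv / (k d_u), where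
   K_uv is the mean of q_t(u,v)^2.  K is symmetric, and K_uv = 0 iff u and v have
   no neighbours in a common component of X \ S, so M[S,S] is symmetric iff S is
   degree-separating.  No spectral theorem is needed: by the mean ergodic theorem
   for A |-> U A U^T, K is a Gram matrix in the Frobenius product.  When S is
   degree-separating, K_uv / d_u = K_uv / sqrt (d_u d_v), and M[S,S] is the sum of
   a signless Laplacian and a scaled Gram matrix. *)
Require Import Defs.
From HB Require Import structures.
From mathcomp Require Import all_boot all_order all_algebra.
From mathcomp Require Import classical_sets reals topology normedtype sequences.
From mathcomp Require Import boolp ring lra zify.
Import Order.TTheory GRing.Theory Num.Theory.
Import numFieldNormedType.Exports.

Set Implicit Arguments.
Unset Strict Implicit.
Unset Printing Implicit Defensive.

Local Open Scope ring_scope.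

(** * Cesaro means *)

Section Cesaro.
Variable R : realType.

Definition cesaro (a : nat -> R) (T : nat) : R :=
  T%:R^-1 * \sum_(0 <= t < T) a t.

(** The error of the mean is at most [B / T], so an average can be read off from a bounded
    discrepancy of its partial sums. *)
Lemma cesaro_cvg (a : nat -> R) (c B : R) :
  (forall T, `|\sum_(0 <= t < T) a t - T%:R * c| <= B) ->
  (cesaro a @ \oo --> c)%classic.
Proof.
move=> aB; apply/cvgrPdist_le => eps eps0.
have /cvgrPdist_le h := @cvg_harmonic R.
have [N _ hN] := h (eps / (B + 1))
  (divr_gt0 eps0 (ltr_wpDl (le_trans (normr_ge0 _) (aB 0%N)) ltr01)).
(* The harmonic sequence at [T] is 1/(T+1), which matches the mean over [T.+1] terms; hence the
   shift, which also drops the empty mean. *)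
exists N.+1 => // -[//|T] /= /hN; rewrite /harmonic /= sub0r normrN => hT.
have B0 : 0 <= B by exact: le_trans (normr_ge0 _) (aB 0%N).
have T0 : T.+1%:R != 0 :> R by rewrite pnatr_eq0.
have -> : c - cesaro a T.+1 =
    - (T.+1%:R^-1 * (\sum_(0 <= t < T.+1) a t - T.+1%:R * c)).
  by rewrite /cesaro mulrBr mulKf // opprB.
rewrite normrN normrM.
apply: le_trans (ler_wpM2l (normr_ge0 _) (aB _)) _.
move: hT; rewrite ler_pdivlMr ?ltr_wpDl // => hT.
by apply: le_trans hT; rewrite ler_wpM2l // lerDl ler01.
Qed.

Lemma eq_cesaro_cvg (a b : nat -> R) (c : R) : a =1 b ->
  (cesaro a @ \oo --> c)%classic -> (cesaro b @ \oo --> c)%classic.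
Proof. by move=> /funext ->. Qed.

Lemma cesaro_cvgD (a b : nat -> R) (c d : R) :
  (cesaro a @ \oo --> c)%classic -> (cesaro b @ \oo --> d)%classic ->
  (cesaro (fun t => a t + b t) @ \oo --> c + d)%classic.
Proof.
move=> ac bd; have -> : cesaro (fun t => a t + b t) =
    (fun T => cesaro a T + cesaro b T).
  by apply/funext => T; rewrite /cesaro big_split mulrDr.
exact: cvgD.
Qed.

Lemma cesaro_cvgZ (a : nat -> R) (x c : R) :
  (cesaro a @ \oo --> c)%classic ->
  (cesaro (fun t => x * a t) @ \oo --> x * c)%classic.
Proof.
move=> ac; have -> : cesaro (fun t => x * a t) = (fun T => x * cesaro a T).
  by apply/funext => T; rewrite /cesaro -mulr_sumr mulrCA.
exact: cvgMr.
Qed.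

Lemma cesaro_cvg_sum (I : finType) (a : I -> nat -> R) (c : I -> R) :
  (forall i, (cesaro (a i) @ \oo --> c i)%classic) ->
  (cesaro (fun t => \sum_i a i t) @ \oo --> \sum_i c i)%classic.
Proof.
move=> ac; elim: (index_enum I) => [|i s IH].
  rewrite big_nil; apply: (@cesaro_cvg _ _ 0) => T.
  by rewrite big1 => [|t _]; rewrite ?big_nil // mulr0 subrr normr0.
rewrite big_cons; apply: eq_cesaro_cvg (cesaro_cvgD (ac i) IH) => t.
by rewrite big_cons.
Qed.

Lemma cesaro_cvg_unique (a : nat -> R) (c d : R) :
  (cesaro a @ \oo --> c)%classic -> (cesaro a @ \oo --> d)%classic -> c = d.
Proof.
move=> ac ad.
by rewrite -(cvg_lim (@Rhausdorff R) ac) (cvg_lim (@Rhausdorff R) ad).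
Qed.

Lemma cesaro_cvg_ge (a : nat -> R) (c d : R) :
  (cesaro a @ \oo --> c)%classic -> (forall t, d <= a t) -> d <= c.
Proof.
move=> ac ad; rewrite -(cvg_lim (@Rhausdorff R) ac).
apply: limr_ge; first by apply/cvg_ex; exists c.
exists 1%N => // T /= T1.
rewrite /cesaro mulrC ler_pdivlMr ?ltr0n // mulr_natr.
have -> : d *+ T = \sum_(0 <= t < T) d by rewrite sumr_const_nat subn0.
exact: ler_sum.
Qed.

Lemma cesaro_even : (cesaro (fun t => (~~ odd t)%:R) @ \oo --> (2^-1 : R))%classic.
Proof.
apply: (@cesaro_cvg _ _ 1) => T.
have -> : \sum_(0 <= t < T) (~~ odd t)%:R = (uphalf T)%:R :> R.
  elim: T => [|T IH]; first by rewrite big_geq.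
  rewrite big_nat_recr //= IH -natrD; congr (_%:R).
  by rewrite uphalf_half; case: (odd T) => /=; lia.
have -> : (T%:R : R) = (odd T)%:R + (T./2)%:R * 2.
  by rewrite -natrM -natrD muln2 odd_double_half.
rewrite uphalf_half natrD ler_norml; case: (odd T) => /=; lra.
Qed.

Lemma cesaro_odd : (cesaro (fun t => (odd t)%:R) @ \oo --> (2^-1 : R))%classic.
Proof.
apply: (@cesaro_cvg _ _ 1) => T.
have -> : \sum_(0 <= t < T) (odd t)%:R = (T./2)%:R :> R.
  elim: T => [|T IH]; first by rewrite big_geq.
  rewrite big_nat_recr //= IH -natrD; congr (_%:R).
  by rewrite uphalf_half addnC.
have -> : (T%:R : R) = (odd T)%:R + (T./2)%:R * 2.
  by rewrite -natrM -natrD muln2 odd_double_half.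
rewrite ler_norml; case: (odd T) => /=; lra.
Qed.

End Cesaro.

(** * The mean ergodic theorem for conjugation by an orthogonal matrix *)

Section Frobenius.
Variables (R : realType) (m n : nat).
Implicit Types X Y Z : 'M[R]_(m, n).

Definition frob X Y : R := \tr (X^T *m Y).

Lemma frobE X Y : frob X Y = \sum_j \sum_i X i j * Y i j.
Proof.
rewrite /frob /mxtrace; apply: eq_bigr => j _; rewrite mxE.
by apply: eq_bigr => i _; rewrite mxE.
Qed.

Lemma frobC X Y : frob X Y = frob Y X.
Proof. by rewrite /frob -mxtrace_tr trmx_mul trmxK. Qed.

Lemma frobBr X Y Z : frob X (Y - Z) = frob X Y - frob X Z.
Proof. by rewrite /frob mulmxBr linearB. Qed.

Lemma frobZl (s : R) X Y : frob (s *: X) Y = s * frob X Y.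
Proof. by rewrite /frob linearZ -scalemxAl linearZ. Qed.

Lemma frob_suml (I : finType) (c : I -> R) (X : I -> 'M[R]_(m, n)) Z :
  frob (\sum_i c i *: X i) Z = \sum_i c i * frob (X i) Z.
Proof.
rewrite /frob linear_sum mulmx_suml linear_sum; apply: eq_bigr => i _.
exact: frobZl.
Qed.

Lemma frob_ge0 X : 0 <= frob X X.
Proof. by rewrite frobE; do 2!apply: sumr_ge0 => ? _; rewrite -expr2 sqr_ge0. Qed.

Lemma frob_eq0 X : frob X X = 0 -> X = 0.
Proof.
rewrite frobE => /eqP X0; apply/matrixP => i j; rewrite mxE.
move: X0; rewrite psumr_eq0; last first.
  by move=> ? _; apply: sumr_ge0 => ? _; rewrite -expr2 sqr_ge0.
move=> /allP /(_ j (mem_index_enum _)) /=; rewrite psumr_eq0; last first.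
  by move=> ? _; rewrite -expr2 sqr_ge0.
by move=> /allP /(_ i (mem_index_enum _)) /=; rewrite mulf_eq0 orbb => /eqP.
Qed.

(** Entrywise |xy| <= x^2 + y^2. This weak Cauchy-Schwarz inequality avoids square roots and
    suffices for the bounds below. *)
Lemma frob_amgm X Y : `|frob X Y| <= frob X X + frob Y Y.
Proof.
rewrite !frobE -big_split /=; apply: le_trans (ler_norm_sum _ _ _) _.
apply: ler_sum => j _; rewrite -big_split /=.
apply: le_trans (ler_norm_sum _ _ _) _; apply: ler_sum => i _.
by rewrite ler_norml; apply/andP; split; nra.
Qed.

End Frobenius.

(** * Orbits under conjugation, their means, and recurrence *)

Section MeanErgodic.
Variables (R : realType) (n : nat).
Implicit Types (X Y Z A B : 'M[R]_n) (x y z : 'cV[R]_n).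

Variable U : 'M[R]_n.
Hypothesis Uorth : U *m U^T = 1%:M.

(** Squared amplitudes are quadratic in a state [y] but linear in [y *m y^T], so the evolution is
    followed on matrices, by conjugation. *)
Definition orbit t X : 'M[R]_n := U ^+ t *m X *m (U ^+ t)^T.

Lemma orthX t : U ^+ t *m (U ^+ t)^T = 1%:M.
Proof.
elim: t => [|t IH]; first by rewrite expr0 mul1mx trmx1.
by rewrite exprSr -mulmxE trmx_mul mulmxA -(mulmxA _ U) Uorth mulmx1.
Qed.

Lemma orthTX t : (U ^+ t)^T *m U ^+ t = 1%:M.
Proof. exact/mulmx1C/orthX. Qed.

Lemma frob_orth t x y : frob (U ^+ t *m x) (U ^+ t *m y) = frob x y.
Proof. by rewrite /frob trmx_mul -mulmxA (mulmxA _ (U ^+ t)) orthTX mul1mx. Qed.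

Lemma orbitS t X : orbit t.+1 X = orbit t (U *m X *m U^T).
Proof. by rewrite /orbit exprSr -mulmxE trmx_mul !mulmxA. Qed.

Lemma frob_orbit t X Y : frob (orbit t X) (orbit t Y) = frob X Y.
Proof.
rewrite /frob /orbit !trmx_mul trmxK !mulmxA.
rewrite -(mulmxA _ (U ^+ t)^T) orthTX mulmx1 mxtrace_mulC !mulmxA orthTX mul1mx.
by [].
Qed.

(* Im (1 - Phi) is orthogonal to Ker (1 - Phi), since Phi is an isometry of
   the Frobenius product, and by rank-nullity the two span everything. *)
Lemma coboundary_decomposition Y :
  exists A B, U *m A *m U^T = A /\ Y = A + (B - U *m B *m U^T).
Proof.
pose phi := mulmxr U^T \o mulmx U : 'M[R]_n -> 'M[R]_n.
pose L := lin_mx phi; pose D := 1%:M - L.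
have mulD X : mxvec X *m D = mxvec (X - U *m X *m U^T).
  by rewrite mulmxBr mulmx1 mul_vec_lin linearB.
have cap0 : (kermx D :&: D)%MS = 0.
  apply/eqP; rewrite -submx0; apply/rV_subP => v.
  rewrite sub_capmx => /andP[/sub_kermxP vD /submxP[w vw]].
  rewrite -(vec_mxK v) in vD vw *; rewrite -(vec_mxK w) in vw.
  move: vD vw; rewrite !mulD; move: (vec_mx v) (vec_mx w) => X B XD XB.
  have {}XD : U *m X *m U^T = X.
    by apply/eqP; rewrite eq_sym -subr_eq0; apply/eqP/(can_inj mxvecK); rewrite XD linear0.
  have {}XB : X = B - U *m B *m U^T by exact/(can_inj mxvecK).
  suff -> : X = 0 by rewrite linear0 sub0mx.
  apply: frob_eq0; rewrite {2}XB frobBr -{2}XD.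
  have := frob_orbit 1 X B; rewrite /orbit expr1 => ->.
  by rewrite subrr.
have full : row_full (kermx D + D)%MS.
  by rewrite /row_full mxrank_disjoint_sum // mxrank_ker subnK // rank_leq_row.
have /sub_addsmxP[[u1 u2] /=] : (mxvec Y <= kermx D + D)%MS by exact: submx_full.
pose a := u1 *m kermx D; move=> Ya.
exists (vec_mx a), (vec_mx u2); split.
  apply/eqP; rewrite eq_sym -subr_eq0; apply/eqP/(can_inj mxvecK).
  by rewrite -mulD vec_mxK linear0 /a -mulmxA mulmx_ker mulmx0.
apply/(can_inj mxvecK); rewrite linearD /= -mulD !vec_mxK; exact: Ya.
Qed.

(** The fixed part of [Y] is constant along the orbit and the coboundary part telescopes to
    [frob Z B - frob Z (orbit T B)], which is bounded in [T] because conjugation is an isometry. *)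
Lemma mean_ergodic Y : exists A, U *m A *m U^T = A /\
  forall Z, (cesaro (fun t => frob Z (orbit t Y)) @ \oo --> frob Z A)%classic.
Proof.
have [A [B [UA YAB]]] := coboundary_decomposition Y.
exists A; split=> // Z.
apply: (@cesaro_cvg _ _ _ (`|frob Z B| + (frob Z Z + frob B B))) => T.
have -> : \sum_(0 <= t < T) frob Z (orbit t Y) - T%:R * frob Z A =
    frob Z B - frob Z (orbit T B).
  elim: T => [|T IH].
    by rewrite big_geq // mul0r /orbit expr0 mul1mx trmx1 mulmx1 !subrr.
  have orbitA t : orbit t A = A.
    elim: t => [|t IHt]; first by rewrite /orbit expr0 mul1mx trmx1 mulmx1.
    by rewrite orbitS UA.
  rewrite big_nat_recr //= -natr1 mulrDl mul1r opprD addrACA IH.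
  have -> : orbit T Y = orbit T A + (orbit T B - orbit T.+1 B).
    by rewrite orbitS {1}YAB /orbit !(mulmxDr, mulmxDl, mulmxN, mulNmx).
  rewrite orbitA /frob mulmxDr mulmxBr !linearD /= linearN /=.
  ring.
apply: le_trans (ler_normB _ _) _; rewrite lerD2l.
by apply: le_trans (frob_amgm _ _) _; rewrite frob_orbit.
Qed.

(** Tested against the invariant matrix [A], the orbit of [Y] gives a constant sequence. Thus [A] is
    the orthogonal projection of [Y] onto the matrices commuting with [U]. *)
Lemma frob_invariant Y A : U *m A *m U^T = A ->
  (forall Z, (cesaro (fun t => frob Z (orbit t Y)) @ \oo --> frob Z A)%classic) ->
  frob Y A = frob A A.
Proof.
move=> UA YA; apply: cesaro_cvg_unique (YA A).
apply: (@cesaro_cvg _ _ _ 0) => T.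
rewrite (eq_bigr (fun=> frob Y A)) => [|t _].
  by rewrite sumr_const_nat subn0 mulr_natl subrr normr0.
rewrite -[RHS](frob_orbit t) frobC; congr frob.
elim: t => [|t IHt]; first by rewrite /orbit expr0 mul1mx trmx1 mulmx1.
by rewrite orbitS UA.
Qed.

Lemma frob_rank1 z w X : frob (z *m w^T) X = (z^T *m X *m w) 0 0.
Proof.
by rewrite /frob trmx_mul trmxK mxtrace_mulC mulmxA mxtrace_mulC trace_mx11 mulmxA.
Qed.

Lemma orbit_rank1 t z w y : frob (z *m w^T) (orbit t (y *m y^T)) =
  (z^T *m U ^+ t *m y) 0 0 * (w^T *m U ^+ t *m y) 0 0.
Proof.
rewrite frob_rank1 /orbit.
have -> : z^T *m (U ^+ t *m (y *m y^T) *m (U ^+ t)^T) *m w =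
    (z^T *m U ^+ t *m y) *m (w^T *m U ^+ t *m y)^T.
  by rewrite !trmx_mul trmxK !mulmxA.
by rewrite mxE big_ord1 [X in _ * X]mxE.
Qed.

(** A zero mean of squares forces every term to vanish. The mean [A] of the orbit of [y *m y^T] is
    positive semidefinite and commutes with [U]; its left kernel contains [z^T], hence every
    [z^T *m U ^+ t], and [y] is orthogonal to that kernel. *)
Lemma recurrence y z :
  (cesaro (fun t => ((z^T *m U ^+ t *m y) 0 0) ^+ 2) @ \oo --> (0 : R))%classic ->
  forall t, (z^T *m U ^+ t *m y) 0 0 = 0.
Proof.
have [A [UA yA]] := mean_ergodic (y *m y^T); move=> yz0.
have zAz : frob (z *m z^T) A = 0.
  apply: cesaro_cvg_unique (yA _) _; apply: eq_cesaro_cvg yz0 => t.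
  by rewrite orbit_rank1.
have A_ge0 (w : 'cV_n) : 0 <= frob (w *m w^T) A.
  by apply: cesaro_cvg_ge (yA _) _ => t; rewrite orbit_rank1 -expr2 sqr_ge0.
have A_sym (v w : 'cV_n) : frob (v *m w^T) A = frob (w *m v^T) A.
  apply: cesaro_cvg_unique (yA _) _; apply: eq_cesaro_cvg (yA _) => t.
  by rewrite !orbit_rank1 mulrC.
(* On the line [s *: z + w] the quadratic term in [s] is zero, so the form is affine in [s] and
   nonnegative everywhere; its slope must vanish. *)
have zA (w : 'cV_n) : frob (z *m w^T) A = 0.
  have quad s : 0 <= 2 * s * frob (z *m w^T) A + frob (w *m w^T) A.
    have := A_ge0 (s *: z + w).
    rewrite linearD /= linearZ /= !mulmxDl !mulmxDr.
    rewrite -!scalemxAl -!scalemxAr /frob !linearD /= !linearZ /=.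
    rewrite !mulmxDl -!scalemxAl !linearD /= !linearZ /=.
    rewrite -![\tr _]/(frob _ _) zAz (A_sym w z).
    by move=> h; apply: le_trans h _; lra.
  apply/eqP/negPn/negP => b0.
  (* This value of [s] makes the affine function equal to -1. *)
  have := quad (- (frob (w *m w^T) A + 1) / (2 * frob (z *m w^T) A)).
  have -> : 2 * (- (frob (w *m w^T) A + 1) / (2 * frob (z *m w^T) A)) *
    frob (z *m w^T) A = - (frob (w *m w^T) A + 1) by field.
  lra.
have {}zA : z^T *m A = 0.
  apply/matrixP => i j; rewrite [i]ord1 [RHS]mxE -(zA (delta_mx j 0)) frob_rank1.
  by rewrite -colE [RHS]mxE.
have UAt t : U ^+ t *m A = A *m U ^+ t.
  have UA1 : U *m A = A *m U.
    by rewrite -{2}UA -!mulmxA (mulmx1C Uorth) mulmx1.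
  exact/esym/(commrX t (esym UA1)).
have VAt t : (U ^+ t)^T *m A = A *m (U ^+ t)^T.
  rewrite -[LHS]mulmx1 -(orthX t) mulmxA -(mulmxA _ A) -UAt.
  by rewrite (mulmxA _ (U ^+ t)) orthTX mul1mx.
(* The rows of [N] span the left kernel of [A], and [E], acting on rows from the right, projects
   onto it. *)
pose N := kermx A; pose E := pinvmx N *m N.
have NA : N *m A = 0 by exact: mulmx_ker.
have NE m (M : 'M_(m, n)) : M *m A = 0 -> M *m E = M.
  by move=> MA; rewrite /E mulmxA mulmxKpV //; apply/sub_kermxP.
have EA : E *m A = 0 by rewrite /E -mulmxA NA mulmx0.
clearbody E.
have NP m (M : 'M_(m, n)) : M *m A = 0 -> exists c, M = c *m N.
  by move/sub_kermxP/submxP.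
clearbody N.
have EA0 : frob (E^T *m E) A = 0.
  by rewrite /frob trmx_mul trmxK -mulmxA EA mulmx0 linear0.
suff Ny : N *m y = 0.
  move=> t; have /NP[c ->] : z^T *m U ^+ t *m A = 0.
    by rewrite -mulmxA UAt mulmxA zA mul0mx.
  by rewrite -mulmxA Ny mulmx0 mxE.
apply: frob_eq0.
pose x := N^T *m (N *m y).
(* The squared norms of [E *m U ^+ t *m y] have mean [frob (E^T *m E) A], which is 0. Pairing these
   vectors with [U ^+ t *m x] always gives the squared norm of [N *m y], whence a lower bound free
   of [t]. *)
have bound s t : s * frob (N *m y) (N *m y) - s ^+ 2 * frob x x <=
    frob (E^T *m E) (orbit t (y *m y^T)).
  have -> : frob (E^T *m E) (orbit t (y *m y^T)) =
      frob (E *m U ^+ t *m y) (E *m U ^+ t *m y).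
    transitivity (\tr ((E^T *m (E *m (U ^+ t *m y))) *m (U ^+ t *m y)^T)).
      by rewrite /frob /orbit !trmx_mul trmxK !mulmxA.
    by rewrite mxtrace_mulC /frob !trmx_mul !mulmxA.
  rewrite -(frob_orth t x x).
  have -> : frob (N *m y) (N *m y) = frob (U ^+ t *m x) (E *m U ^+ t *m y).
    have NVE : N *m (U ^+ t)^T *m E = N *m (U ^+ t)^T.
      by apply: NE; rewrite -mulmxA VAt mulmxA NA mul0mx.
    rewrite /frob [in RHS]trmx_mul {1}/x [(N^T *m _)^T]trmx_mul trmxK.
    rewrite -!mulmxA (mulmxA N) (mulmxA (N *m _)) NVE -(mulmxA N).
    by rewrite (mulmxA _ (U ^+ t)) orthTX mul1mx.
  have := frob_amgm (s *: (U ^+ t *m x)) (E *m U ^+ t *m y).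
  rewrite !frobZl [frob _ (s *: _)]frobC frobZl mulrA -expr2.
  by rewrite ler_norml => /andP[_]; lra.
have lim s : s * frob (N *m y) (N *m y) - s ^+ 2 * frob x x <= 0.
  by rewrite -EA0; apply: cesaro_cvg_ge (yA _) (bound s).
have c0 := frob_ge0 (N *m y); have d0 := frob_ge0 x.
move: (frob _ _) (frob x x) c0 d0 lim => c d c0 d0 lim.
have d1 : d + 1 != 0 by rewrite lt0r_neq0 // ltr_wpDl.
(* A nearly optimal [s], with [d + 1] in place of [d] so that the denominator is nonzero; the bound
   becomes (c/(d+1))^2 <= 0. *)
have := lim (c / (d + 1)).
have -> : c / (d + 1) * c - (c / (d + 1)) ^+ 2 * d = (c / (d + 1)) ^+ 2 by field.
move=> h; have /eqP : (c / (d + 1)) ^+ 2 = 0 by apply/le_anti; rewrite h sqr_ge0.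
by rewrite sqrf_eq0 mulf_eq0 invr_eq0 (negPf d1) orbF => /eqP.
Qed.

End MeanErgodic.

(** * The walk on arcs *)

Section Arcs.
Variables (V : finType) (e : rel V).
Hypothesis e_sym : symmetric e.
Local Notation arc := (Defs.arc e).
Implicit Types (a b : arc) (u v w : V).

Lemma arcP a : e (arc_tail a) (arc_head a).
Proof. exact: valP a. Qed.

Lemma arc_revP a : e (arc_head a) (arc_tail a).
Proof. by rewrite e_sym arcP. Qed.

Definition arc_rev a : arc := Sub (arc_head a, arc_tail a) (arc_revP a).

Lemma tail_rev a : arc_tail (arc_rev a) = arc_head a. Proof. by []. Qed.
Lemma head_rev a : arc_head (arc_rev a) = arc_tail a. Proof. by []. Qed.

Lemma arc_eqE a b : (a == b) = (arc_tail a == arc_tail b) && (arc_head a == arc_head b).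
Proof. by rewrite -val_eqE /arc_tail /arc_head; case: (val a) (val b) => ? ? [? ?]. Qed.

Lemma arc_revK : involutive arc_rev.
Proof. by move=> a; apply/eqP; rewrite arc_eqE !eqxx. Qed.

Lemma sum_arcs_from (R : nmodType) v (P : pred V) (F : V -> R) :
  \sum_(a : arc | (arc_tail a == v) && P (arc_head a)) F (arc_head a) =
  \sum_(w | e v w && P w) F w.
Proof.
rewrite (partition_big (@arc_head V e) (fun w => e v w && P w)) /=; last first.
  by move=> a /andP[/eqP <- ->]; rewrite arcP.
apply: eq_bigr => w /andP[vw Pw].
rewrite (big_pred1 (Sub (v, w) vw : arc)) //= => a.
rewrite /= [RHS]arc_eqE -andbA; congr andb.
by case: eqVneq => [->|]; rewrite ?Pw ?andbF.
Qed.

Lemma sum_arcs_from_all (R : nmodType) v (F : V -> R) :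
  \sum_(a : arc | arc_tail a == v) F (arc_head a) = \sum_(w | e v w) F w.
Proof.
transitivity (\sum_(w | e v w && predT w) F w); last by apply: eq_bigl => w; rewrite andbT.
by rewrite -sum_arcs_from; apply: eq_bigl => a; rewrite andbT.
Qed.

Lemma sum_arcs_to (R : nmodType) v (F : arc -> R) :
  \sum_(a : arc | arc_head a == v) F a =
  \sum_(a : arc | arc_tail a == v) F (arc_rev a).
Proof. by rewrite (reindex_inj (inv_inj arc_revK)). Qed.

End Arcs.

(** * The transition matrix acting on arc amplitudes *)

Section Walk.
Variables (R : realType) (V : finType) (e : rel V) (k : nat) (S : {set V}).
Hypothesis e_sym : symmetric e.
Hypothesis ereg : regular_graph e k.
Local Notation arc := (Defs.arc e).
Local Notation n := #|{: arc}|.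
Local Notation U := (transition R e k S).
Implicit Types (a b : arc) (u v w : V) (psi : 'cV[R]_n).

Local Notation rv := (arc_rev e_sym).

Definition at_arc psi a : R := psi (enum_rank a) 0.

Definition out_sum psi w := \sum_(a | arc_tail a == w) at_arc psi a.
Definition in_sum psi w := \sum_(a | arc_head a == w) at_arc psi a.

(** The Grover reflection at unmarked tails and the scalar -1 at marked ones. *)
Definition coin : 'M[R]_n := (2%:R / k%:R) *:
    ((tail_incidence R e)^T *m marked_oracle R S *m tail_incidence R e) - 1%:M.

Lemma transitionE : U = arc_reversal R e *m coin. Proof. by []. Qed.

Lemma reversalE psi a : at_arc (arc_reversal R e *m psi) a = at_arc psi (rv a).
Proof.
rewrite /at_arc mxE (bigD1 (enum_rank (rv a))) //= big1 => [|j ja].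
  by rewrite addr0 mxE !enum_rankK /= !eqxx mul1r.
rewrite mxE enum_rankK andbC; have -> : (arc_head a == arc_tail (enum_val j)) &&
    (arc_tail a == arc_head (enum_val j)) = (rv a == enum_val j).
  by rewrite arc_eqE.
by rewrite eq_sym (can2_eq (@enum_valK _) (@enum_rankK _)) (negPf ja) mul0r.
Qed.

Lemma tail_incidenceE psi i :
  (tail_incidence R e *m psi) i 0 = out_sum psi (enum_val i).
Proof.
rewrite mxE (reindex (@enum_rank arc)) /=; last exact/onW_bij/enum_rank_bij.
rewrite /out_sum [RHS]big_mkcond; apply: eq_bigr => a _.
by rewrite mxE enum_rankK eq_sym; case: eqP; rewrite ?mul1r ?mul0r.
Qed.

Lemma oracleE (x : 'cV[R]_#|V|) i :
  (marked_oracle R S *m x) i 0 = (enum_val i \notin S)%:R * x i 0.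
Proof.
rewrite mxE (bigD1 i) //= big1 => [|j ji].
  by rewrite addr0 mxE eqxx andbb; case: (_ \in S).
by rewrite mxE eq_sym (negPf ji); case: ifP; rewrite mul0r.
Qed.

Lemma coinE psi a : at_arc (coin *m psi) a =
  2%:R / k%:R * ((arc_tail a \notin S)%:R * out_sum psi (arc_tail a)) - at_arc psi a.
Proof.
rewrite /at_arc /coin mulmxBl mul1mx mxE [in X in _ + X]mxE -scalemxAl mxE.
congr (_ * _ - _); rewrite -!mulmxA mxE (bigD1 (enum_rank (arc_tail a))) //=.
rewrite oracleE tail_incidenceE enum_rankK big1 => [|i ia]; last first.
  by rewrite !mxE enum_rankK (can2_eq (@enum_valK _) (@enum_rankK _)) (negPf ia) mul0r.
by rewrite addr0 !mxE !enum_rankK eqxx mul1r.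
Qed.

Lemma stepE psi a : at_arc (U *m psi) a =
  2%:R / k%:R * ((arc_head a \notin S)%:R * out_sum psi (arc_head a)) - at_arc psi (rv a).
Proof. by rewrite transitionE -mulmxA reversalE coinE. Qed.


Lemma at_arcP psi psi' : at_arc psi =1 at_arc psi' -> psi = psi'.
Proof.
by move=> eq_psi; apply/colP => i; have := eq_psi (enum_val i); rewrite /at_arc enum_valK.
Qed.

Lemma card_tail w (x : R) : \sum_(a : arc | arc_tail a == w) x = k%:R * x.
Proof.
rewrite (sum_arcs_from_all e w (fun=> x)) sumr_const mulr_natl; congr (_ *+ _).
by rewrite -(ereg w) /nbhd cardsE; apply: eq_card.
Qed.

Lemma degree_neq0 a : k%:R != 0 :> R.
Proof.
rewrite pnatr_eq0 -lt0n -(ereg (arc_tail a)); apply/card_gt0P.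
by exists (arc_head a); rewrite inE arcP.
Qed.

(* The cancellation of k is legitimate even for k = 0, all arc sums being empty. *)
Lemma sum_grover w psi :
  \sum_(a : arc | arc_tail a == w) 2%:R / k%:R * out_sum psi w = 2%:R * out_sum psi w.
Proof.
case: (pickP (fun a : arc => arc_tail a == w)) => [a _|none].
  by rewrite card_tail; field; exact: degree_neq0 a.
by rewrite /out_sum !big_pred0 // mulr0.
Qed.

Lemma mx_id_eq1 (M : 'M[R]_n) : (forall psi, M *m psi = psi) -> M = 1%:M.
Proof.
move=> M1; apply/matrixP => i j; have := M1 (delta_mx j 0).
by rewrite -colE => /colP/(_ i); rewrite !mxE andbT.
Qed.

Lemma coin_invol : coin *m coin = 1%:M.
Proof.
apply: mx_id_eq1 => psi; apply: at_arcP => a; rewrite -mulmxA !coinE.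
have [aS|aS] := boolP (arc_tail a \in S).
  by rewrite !mul0r mulr0 !sub0r opprK.
rewrite !mul1r {1}/out_sum (eq_bigr (fun b =>
  2%:R / k%:R * out_sum psi (arc_tail a) - at_arc psi b)) => [|b /eqP ba]; last first.
  by rewrite coinE ba aS mul1r.
rewrite sumrB sum_grover -/(out_sum _ _); ring.
Qed.

Lemma reversal_invol : arc_reversal R e *m arc_reversal R e = 1%:M.
Proof.
by apply: mx_id_eq1 => psi; apply: at_arcP => a; rewrite -mulmxA !reversalE arc_revK.
Qed.

Lemma tr_reversal : (arc_reversal R e)^T = arc_reversal R e.
Proof.
apply/matrixP => i j; rewrite !mxE [in RHS]andbC.
by congr ((nat_of_bool (_ && _))%:R); exact: eq_sym.
Qed.

Lemma tr_coin : coin^T = coin.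
Proof.
have trO : (marked_oracle R S)^T = marked_oracle R S.
  by apply/matrixP => i j; rewrite !mxE andbC eq_sym.
by rewrite /coin linearB linearZ /= !trmx_mul trmxK trO trmx1 mulmxA.
Qed.

Lemma transition_orth : U *m U^T = 1%:M.
Proof.
rewrite transitionE trmx_mul tr_reversal tr_coin mulmxA -(mulmxA _ coin coin).
by rewrite coin_invol mulmx1 reversal_invol.
Qed.

(** Time reversal: [U] is a product of two symmetric involutions, so conjugating by the coin turns
    it into its inverse. *)
Lemma tr_transitionX t : (U ^+ t)^T = coin *m U ^+ t *m coin.
Proof.
have trU : U^T = coin *m arc_reversal R e.
  by rewrite transitionE trmx_mul tr_reversal tr_coin.
have Ucoin : U *m coin = arc_reversal R e.
  by rewrite transitionE -mulmxA coin_invol mulmx1.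
move: U coin (arc_reversal R e) coin_invol trU Ucoin => W C Q CC trW WC.
elim: t => [|t IH]; first by rewrite expr0 trmx1 mulmx1 CC.
rewrite [in LHS]exprS exprSr -!mulmxE trmx_mul IH trW -!mulmxA WC.
by rewrite (mulmxA C C) CC mul1mx.
Qed.

Definition probe v : 'cV[R]_n := \col_i
  ((arc_tail (enum_val i) == v) && (arc_head (enum_val i) \notin S))%:R.

Lemma probeE v a : at_arc (probe v) a = ((arc_tail a == v) && (arc_head a \notin S))%:R.
Proof. by rewrite /at_arc mxE enum_rankK. Qed.

Lemma coin_probe v : v \in S -> coin *m probe v = - probe v.
Proof.
move=> vS; apply: at_arcP => a; rewrite coinE.
have [aS|aS] := boolP (arc_tail a \in S).
  by rewrite mul0r mulr0 sub0r [RHS]mxE.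
rewrite /out_sum big1 ?mulr0 ?sub0r ?[RHS]mxE // => b /eqP ba.
by rewrite probeE ba; case: eqP => // av; rewrite av vS in aS.
Qed.

Definition corr t u v : R := ((probe u)^T *m U ^+ t *m probe v) 0 0.

(* U^T = coin U coin, and the probes are (-1)-eigenvectors of the coin. *)
Lemma corrC t u v : u \in S -> v \in S -> corr t u v = corr t v u.
Proof.
have tr1 (M : 'M[R]_1) : M 0 0 = M^T 0 0 by rewrite mxE.
move=> uS vS; rewrite /corr [LHS]tr1 !trmx_mul trmxK tr_transitionX.
rewrite -!mulmxA coin_probe // !mulmxN !mulmxA.
have -> : (probe v)^T *m coin = - (probe v)^T.
  by rewrite -{1}tr_coin -trmx_mul coin_probe // linearN.
by rewrite !mulNmx opprK.
Qed.

Lemma corrE t u v : corr t u v =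
  \sum_(a : arc | (arc_tail a == u) && (arc_head a \notin S)) at_arc (U ^+ t *m probe v) a.
Proof.
rewrite /corr -mulmxA mxE (reindex (@enum_rank arc)) /=; last exact/onW_bij/enum_rank_bij.
rewrite [RHS]big_mkcond; apply: eq_bigr => a _.
have -> : (probe u)^T 0 (enum_rank a) = at_arc (probe u) a by rewrite mxE.
by rewrite probeE; case: ifP => _; rewrite ?mul1r ?mul0r.
Qed.

(** Together with [in_sum_step] this closes the dynamics on functions of unmarked vertices:
    eliminating the in-sums leaves the second-order Chebyshev recurrence. *)
Lemma out_sum_step psi w : out_sum (U *m psi) w =
  2%:R / k%:R * (\sum_(x | e w x && (x \notin S)) out_sum psi x) - in_sum psi w.
Proof.
rewrite /out_sum; under eq_bigr do rewrite (stepE psi).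
rewrite sumrB /in_sum (sum_arcs_to e_sym); congr (_ - _).
rewrite -mulr_sumr; congr (_ * _); rewrite -sum_arcs_from big_mkcondr.
by apply: eq_bigr => a _; case: (_ \in S); rewrite ?mul1r ?mul0r.
Qed.

Lemma in_sum_step psi w : w \notin S -> in_sum (U *m psi) w = out_sum psi w.
Proof.
move=> wS; rewrite /in_sum (sum_arcs_to e_sym).
rewrite (eq_bigr (fun b => 2%:R / k%:R * out_sum psi w - at_arc psi b)) => [|b /eqP bw].
  by rewrite sumrB sum_grover -/(out_sum _ _); ring.
by rewrite stepE head_rev arc_revK bw wS mul1r.
Qed.

End Walk.

(** * Walks outside the marked set *)

Lemma num_walksS (V : finType) (f : rel V) m u (T : {set V}) :
  num_walks f m.+1 u T = (\sum_(x | f u x) num_walks f m x T)%N.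
Proof.
have bij : bijective (fun p : V * m.-tuple V => [tuple of p.1 :: p.2]).
  exists (fun t => (thead t, [tuple of behead t])) => [[x p]|t] /=.
    by congr pair; apply: val_inj.
  by rewrite [RHS]tuple_eta; apply: val_inj.
rewrite /num_walks -sum1dep_card (reindex _ (onW_bij _ bij)) /=.
under [RHS]eq_bigr do rewrite -sum1dep_card.
rewrite pair_big_dep /=; apply: eq_bigl => -[x p] /=.
by rewrite andbA.
Qed.

Section Chebyshev.
Variables (R : realType) (V : finType) (e : rel V) (k : nat) (S : {set V}).
Implicit Types (u v w : V) (f g : V -> R).

Definition adj f w : R := \sum_(x | e w x && (x \notin S)) f x.

(* The Chebyshev recurrence at (1/k) times the adjacency operator of X \ S,
   started at the neighbourhood of v. *)
Fixpoint cheb v t : V -> R :=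
  match t with
  | 0 => fun w => (e v w)%:R
  | t1.+1 => match t1 with
             | 0 => fun=> 0
             | t2.+1 => fun w => 2%:R / k%:R * adj (cheb v t1) w - cheb v t2 w
             end
  end.

Lemma chebSS v t w :
  cheb v t.+2 w = 2%:R / k%:R * adj (cheb v t.+1) w - cheb v t w.
Proof. by []. Qed.

(** The two-step induction done once: every property stable under [adj] and the combinations c f - g
    passes from the two initial functions to all [cheb v t]. *)
Lemma cheb_ind (Q : (V -> R) -> Prop) v :
  Q (fun w => (e v w)%:R) -> Q (fun=> 0) -> (forall f, Q f -> Q (adj f)) ->
  (forall c f g, Q f -> Q g -> Q (fun w => c * f w - g w)) ->
  forall t, Q (cheb v t).
Proof.
move=> Qv Q0 Qadj Qlin; suff Q2 t : Q (cheb v t) /\ Q (cheb v t.+1).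
  by move=> t; have [] := Q2 t.
by elim: t => [|t [Qt Qt1]]; split=> //; apply: Qlin => //; exact: Qadj.
Qed.

Lemma adjBZ c f g w : adj (fun x => c * f x - g x) w = c * adj f w - adj g w.
Proof. by rewrite /adj sumrB mulr_sumr. Qed.

Lemma eq_adj f g : f =1 g -> adj f =1 adj g.
Proof. by move=> fg w; apply: eq_bigr. Qed.

Lemma eq_iter_adj m f g : f =1 g -> iter m adj f =1 iter m adj g.
Proof. by move=> fg; elim: m => //= m IH; exact: eq_adj. Qed.

Lemma iter_adjBZ m c f g w :
  iter m adj (fun x => c * f x - g x) w = c * iter m adj f w - iter m adj g w.
Proof.
by elim: m w => //= m IH w; rewrite (eq_adj IH) adjBZ.
Qed.

Lemma iter_adj0 m w : iter m adj (fun=> 0) w = 0.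
Proof. by elim: m w => //= m IH w; rewrite (eq_adj IH) /adj big1. Qed.

Lemma iter_adj_walks m v w : w \notin S ->
  iter m adj (fun x => (e v x)%:R) w =
  (num_walks (induced e (~: S)) m w (nbhd e v :\: S))%:R.
Proof.
elim: m w => [|m IH] w wS.
  rewrite /= /num_walks; congr (_%:R).
  have -> : [set p : 0.-tuple V | path (induced e (~: S)) w p &&
      (last w p \in nbhd e v :\: S)] = if e v w then [set: 0.-tuple V] else finset.set0.
    by apply/setP => p; rewrite tuple0 !inE /= wS /=; case: ifP; rewrite inE.
  by case: ifP; rewrite ?cards0 // cardsT card_tuple expn0.
rewrite num_walksS natr_sum /= /adj; apply: eq_big => x.
  by rewrite /induced /= !inE wS andbC.
by case/andP=> _ xS; exact: IH.
Qed.

(** Constancy is asked of all iterates because constancy of [f] alone on neighbourhoods need not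
    survive [adj]. *)
Definition nbhd_constant f := forall m a, a \in S -> forall w w',
  w \in nbhd e a :\: S -> w' \in nbhd e a :\: S -> iter m adj f w = iter m adj f w'.

(** For the indicator of the neighbourhood of [v] the iterates count walks ending there, so the base
    case is walk-equitability itself. *)
Lemma cheb_nbhd_constant v t : walk_equitable_nbhds e S -> v \in S ->
  nbhd_constant (cheb v t).
Proof.
move=> equit vS; apply: (cheb_ind (Q := nbhd_constant)) =>
  [m a|m a|f cf m a|c f g cf cg m a] aS w w' wa wa'.
- move: (wa) (wa'); rewrite !inE => /andP[wS _] /andP[w'S _].
  by rewrite !iter_adj_walks // (equit m a v aS vS w w').
- by rewrite !iter_adj0.
- by rewrite -!iterSr; exact: cf wa wa'.
- by rewrite !iter_adjBZ (cf m a aS w w') // (cg m a aS w w').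
Qed.

Definition separated u v := forall x y,
  x \in nbhd e u :&: ~: S -> y \in nbhd e v :&: ~: S ->
  ~~ connect (induced e (~: S)) x y.

(** Vanishing on the whole component of [w] in X \ S is preserved by [adj], and it holds initially
    since [v] has no neighbour in that component. *)
Lemma cheb_separated u v t w : separated u v -> w \in nbhd e u :\: S -> cheb v t w = 0.
Proof.
move=> sep wu.
pose Q f := forall z, z \notin S -> connect (induced e (~: S)) w z -> f z = 0.
have wuS : w \in nbhd e u :&: ~: S by move: wu; rewrite !inE andbC.
have wS : w \notin S by move: wu; rewrite inE => /andP[].
suff : Q (cheb v t) by apply => //; exact: connect0.
apply: (cheb_ind (Q := Q)) => [z zS wz|//|f Qf z zS wz|c f g Qf Qg z zS wz].
- case vz: (e v z) => //; have := sep w z wuS; rewrite !inE vz zS => /(_ isT).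
  by rewrite wz.
- rewrite /adj big1 // => x /andP[zx xS]; apply: Qf => //.
  by apply: connect_trans wz (connect1 _); rewrite /induced /= !inE zS xS.
- by rewrite Qf // Qg // mulr0 subrr.
Qed.

(** If all [cheb v t] vanished at [w], the recurrence solved for its [adj] term would make all
    iterates vanish there too; but at [t = 0] these count walks from [w] to the neighbourhood of
    [v], and the connecting path is one. *)
Lemma cheb_connect v w y : k%:R != 0 :> R ->
  w \notin S -> y \in nbhd e v :\: S ->
  connect (induced e (~: S)) w y -> ~ (forall t, cheb v t w = 0).
Proof.
move=> k0 wS yv /connectP[p wp yE] cheb0.
(* Since [cheb v 1] is zero, index 0 is recovered from index 2, to which [step] applies. *)
have cheb2 z : cheb v 0 z = -1 * cheb v 2 z - 0.
  by rewrite chebSS /= /adj big1 // mulr0 subr0 sub0r mulN1r opprK.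
have step m t : (forall s, iter m adj (cheb v s) w = 0) ->
    iter m.+1 adj (cheb v t.+1) w = 0.
  move=> IH; have := IH t.+2.
  rewrite iterSr (iter_adjBZ m (2%:R / k%:R) (adj (cheb v t.+1)) (cheb v t)) IH subr0.
  by move/eqP; rewrite !mulf_eq0 invr_eq0 pnatr_eq0 (negPf k0) /= => /eqP.
have iter0 m t : iter m adj (cheb v t) w = 0.
  elim: m t => [|m IH] t; first exact: cheb0.
  case: t => [|t]; last exact: step.
  by rewrite (eq_iter_adj m.+1 cheb2) iter_adjBZ iter_adj0 step // mulr0 subrr.
have := iter0 (size p) 0%N; rewrite iter_adj_walks //.
move/eqP; rewrite pnatr_eq0 cards_eq0 => /eqP/setP/(_ (in_tuple p)).
by rewrite !inE /= wp -yE; move: yv; rewrite !inE => ->.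
Qed.

End Chebyshev.

(** * Amplitudes of the walk *)

Section Amplitudes.
Variables (R : realType) (V : finType) (e : rel V) (k : nat) (S : {set V}).
Hypothesis e_sym : symmetric e.
Hypothesis ereg : regular_graph e k.
Local Notation arc := (Defs.arc e).
Local Notation n := #|{: arc}|.
Local Notation U := (transition R e k S).
Implicit Types (a b : arc) (u v w : V) (psi : 'cV[R]_n).

Definition amp v t a : R := at_arc (U ^+ t *m probe R e S v) a.

Lemma transition_powS t psi : U ^+ t.+1 *m psi = U *m (U ^+ t *m psi).
Proof. by rewrite exprS -mulmxE mulmxA. Qed.

Lemma amp0 v a : amp v 0 a = ((arc_tail a == v) && (arc_head a \notin S))%:R.
Proof. by rewrite /amp expr0 mul1mx probeE. Qed.

(** Initially the in-sum at [w] is the indicator of [e v w] and the out-sum is zero, as the probe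
    lives on arcs with tail in [S]. The out-sum runs one step ahead of the in-sum. *)
Lemma sums_cheb v t w : v \in S -> w \notin S ->
  out_sum (U ^+ t *m probe R e S v) w = cheb R e k S v t.+1 w /\
  in_sum (U ^+ t *m probe R e S v) w = cheb R e k S v t w.
Proof.
move=> vS; elim: t w => [|t IH] w wS.
  rewrite expr0 mul1mx; split.
    rewrite /out_sum big1 //= => a /eqP aw; rewrite probeE aw.
    by case: eqP => // wv; rewrite wv vS in wS.
  rewrite /in_sum (sum_arcs_to e_sym).
  under eq_bigr => a aw do rewrite probeE tail_rev head_rev (eqP aw) wS andbT.
  rewrite (sum_arcs_from_all e w (fun x => (x == v)%:R)) /= e_sym; case wv: (e w v).
    by rewrite (bigD1 v) //= eqxx big1 ?addr0 // => x /andP[_ /negPf->].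
  by rewrite big1 // => x wx; case: eqP => // xv; rewrite -xv wx in wv.
rewrite transition_powS; split; last by rewrite in_sum_step // (IH w wS).1.
rewrite out_sum_step // (IH w wS).2 chebSS; congr (_ * _ - _).
by apply: eq_bigr => x /andP[_ xS]; rewrite (IH x xS).1.
Qed.

Lemma amp1 v a : v \in S -> arc_tail a \in S -> arc_head a \notin S -> amp v 1 a = 0.
Proof.
move=> vS aS aS'; rewrite /amp transition_powS (stepE _ _ e_sym).
rewrite (sums_cheb 0 vS aS').1 /= !mulr0 sub0r.
by rewrite -/(amp v 0 _) amp0 head_rev aS andbF oppr0.
Qed.

(** Over two steps the arc is reversed twice with a change of sign each time, which restores the old
    amplitude; only the unmarked head adds a term. *)
Lemma ampSS v t a : v \in S -> arc_tail a \in S -> arc_head a \notin S ->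
  amp v t.+2 a = 2%:R / k%:R * cheb R e k S v t.+2 (arc_head a) + amp v t a.
Proof.
move=> vS aS aS'; rewrite /amp transition_powS (stepE _ _ e_sym) aS' mul1r.
rewrite (sums_cheb t.+1 vS aS').1; congr (_ + _).
by rewrite transition_powS (stepE _ _ e_sym) head_rev aS mul0r mulr0 sub0r opprK arc_revK.
Qed.

(** By [ampSS] the amplitude changes over two steps by a Chebyshev value at the head, and this is
    constant on the neighbourhood of the common tail. *)
Lemma amp_nbhd_constant v t a b : walk_equitable_nbhds e S ->
  v \in S -> arc_tail a \in S -> arc_tail a = arc_tail b ->
  arc_head a \notin S -> arc_head b \notin S -> amp v t a = amp v t b.
Proof.
move=> equit vS aS ab aS' bS'; have bS : arc_tail b \in S by rewrite -ab.
suff [] : amp v t a = amp v t b /\ amp v t.+1 a = amp v t.+1 b by [].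
elim: t => [|t [IH IH1]]; first by rewrite !amp0 !amp1 // ab aS' bS'.
split=> //; rewrite !ampSS // IH; congr (_ * _ + _).
apply: (@cheb_nbhd_constant R V e k S v t.+2 equit vS 0%N _ aS).
  by rewrite !inE aS' arcP.
by rewrite !inE bS' ab arcP.
Qed.

(* The part of the walk staying on arcs inside S only reverses and changes sign. *)
Definition inner v t a : R := if odd t then - (arc_head a == v)%:R else (arc_tail a == v)%:R.

(** Arcs inside [S] evolve apart from the others: reversal preserves both classes, and the coin
    mixes amplitudes only at unmarked vertices, where no inner arc starts. *)
Lemma tail_state v t a : v \in S ->
  at_arc (U ^+ t *m ((tail_incidence R e)^T *m delta_mx (enum_rank v) 0)) a =
  if (arc_tail a \in S) && (arc_head a \in S) then inner v t a else amp v t a.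
Proof.
move=> vS; elim: t a => [|t IH] a.
  rewrite expr0 mul1mx -colE /at_arc !mxE !enum_rankK eq_sym /inner /= amp0.
  case: eqP => [av|_]; last by case: ifP.
  by rewrite av vS; case: (_ \in S).
have eq_out w : w \notin S -> out_sum
    (U ^+ t *m ((tail_incidence R e)^T *m delta_mx (enum_rank v) 0)) w =
    out_sum (U ^+ t *m probe R e S v) w.
  by move=> wS; apply: eq_bigr => b /eqP bw; rewrite IH bw (negPf wS).
rewrite [in LHS]transition_powS (stepE _ _ e_sym) IH tail_rev head_rev andbC.
case: ifP => [/andP[_ aS]|inn].
  by rewrite aS mul0r mulr0 sub0r /inner /=; case: ifP; rewrite ?opprK //.
rewrite /amp transition_powS (stepE _ _ e_sym) -/(amp v t _); congr (_ * _ - _).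
have [//|wS] := boolP (arc_head a \in S); first by rewrite !mul0r.
by rewrite eq_out.
Qed.

Definition deg_in u : R := #|nbhd e u :&: S|%:R.
Definition deg_out u : R := #|nbhd e u :&: ~: S|%:R.

Lemma card_inner u : u \in S ->
  #|[pred a : arc | (arc_tail a == u) && (arc_head a \in S)]|%:R = deg_in u.
Proof.
move=> uS; rewrite -sumr_const (sum_arcs_from e u (mem S) (fun=> 1)) sumr_const.
by rewrite /deg_in; congr (_%:R); apply: eq_card => x; rewrite !inE.
Qed.

Lemma card_outer u :
  #|[pred a : arc | (arc_tail a == u) && (arc_head a \notin S)]|%:R = deg_out u.
Proof.
rewrite -sumr_const (sum_arcs_from e u (fun x => x \notin S) (fun=> 1)) sumr_const.
by rewrite /deg_out; congr (_%:R); apply: eq_card => x; rewrite !inE.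
Qed.

Lemma sum_inner u v t : u \in S -> v \in S ->
  \sum_(a : arc | (arc_tail a == u) && (arc_head a \in S)) inner v t a ^+ 2 =
  (~~ odd t)%:R * ((u == v)%:R * deg_in u) + (odd t)%:R * (e u v)%:R.
Proof.
move=> uS vS; rewrite /inner; case: (odd t) => /=; rewrite ?mul1r ?mul0r ?add0r ?addr0.
  transitivity (\sum_(w | e u w && (w \in S)) (w == v)%:R : R).
    rewrite -(sum_arcs_from e u (mem S) (fun w => (w == v)%:R : R)).
    by apply: eq_bigr => a _; rewrite sqrrN; case: eqP; rewrite ?expr1n ?expr0n.
  case uv: (e u v).
    by rewrite (bigD1 v) ?uv //= eqxx big1 ?addr0 // => x /andP[_ /negPf->].
  by rewrite big1 // => x /andP[ux _]; case: eqP => // xv; rewrite -xv ux in uv.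
rewrite -card_inner // -sumr_const mulr_sumr; apply: eq_bigr => a.
by move=> /andP[/eqP-> _]; rewrite mulr1; case: eqP; rewrite ?expr1n ?expr0n.
Qed.

Lemma corr_amp t u v : corr R e k S t u v =
  \sum_(a : arc | (arc_tail a == u) && (arc_head a \notin S)) amp v t a.
Proof. exact: corrE. Qed.

(** The equality case of Cauchy-Schwarz: all amplitudes in the sum agree, and there are [deg_out u]
    of them. *)
Lemma sum_outer u v t : walk_equitable_nbhds e S -> u \in S -> v \in S ->
  \sum_(a : arc | (arc_tail a == u) && (arc_head a \notin S)) amp v t a ^+ 2 =
  corr R e k S t u v ^+ 2 / deg_out u.
Proof.
move=> equit uS vS; rewrite corr_amp.
case: (pickP [pred a : arc | (arc_tail a == u) && (arc_head a \notin S)]) => [b|none].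
  move=> /andP[/eqP bu bS].
  have const a : (arc_tail a == u) && (arc_head a \notin S) -> amp v t a = amp v t b.
    move=> /andP[/eqP au aS].
    by apply: amp_nbhd_constant => //; rewrite ?au ?bu.
  transitivity (\sum_(a : arc | (arc_tail a == u) && (arc_head a \notin S)) amp v t b ^+ 2).
    by apply: eq_bigr => a /const ->.
  rewrite [in RHS](eq_bigr (fun=> amp v t b)) //.
  rewrite !sumr_const -(mulr_natl (_ ^+ 2)) -(mulr_natl (amp _ _ _)) card_outer.
  have d0 : deg_out u != 0.
    rewrite pnatr_eq0 -lt0n; apply/card_gt0P; exists (arc_head b).
    by rewrite !inE bS -bu arcP.
  by field.
(* Without neighbours of [u] outside [S] both sums are empty, so the zero numerator makes the
   division by zero harmless. *)
by rewrite !big_pred0 // expr0n mul0r.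
Qed.

Lemma vertex_mixingE u v t : walk_equitable_nbhds e S -> u \in S -> v \in S ->
  vertex_mixing R e k S t u v = k%:R^-1 *
    ((~~ odd t)%:R * ((u == v)%:R * deg_in u) + (odd t)%:R * (e u v)%:R +
     corr R e k S t u v ^+ 2 / deg_out u).
Proof.
move=> equit uS vS; rewrite -sum_inner // -sum_outer // /vertex_mixing.
rewrite (bigID (fun a => arc_head a \in S)) /= mulrDr !mulr_sumr; congr (_ + _);
  by apply: eq_bigr => a /andP[/eqP au aS];
  rewrite real_normK ?num_real // /start_state -scalemxAr mxE exprMn exprVn
    sqr_sqrtr // -/(at_arc _ _) tail_state // au uS ?(negPf aS) ?aS.
Qed.

End Amplitudes.

(** * The average mixing matrix *)

Section Limit.
Variables (R : realType) (V : finType) (e : rel V) (k : nat) (S : {set V}).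
Hypothesis e_sym : symmetric e.
Hypothesis ereg : regular_graph e k.
Local Notation U := (transition R e k S).
Local Notation y := (probe R e S).
Local Notation q := (corr R e k S).
Implicit Types u v w : V.

Definition mean_corr u v : R := limn (cesaro (fun t => q t u v ^+ 2)).

Lemma frob_corr t u v :
  frob (y u *m (y u)^T) (orbit U t (y v *m (y v)^T)) = q t u v ^+ 2.
Proof. by rewrite orbit_rank1. Qed.

(** The limit exists by the mean ergodic theorem, since the squared correlation is a Frobenius
    product with the orbit of [y v *m (y v)^T]. *)
Lemma mean_corr_cvg u v :
  (cesaro (fun t => q t u v ^+ 2) @ \oo --> mean_corr u v)%classic.
Proof.
have [A [_ cvA]] := mean_ergodic (transition_orth R S e_sym ereg) (y v *m (y v)^T).
apply/cvg_ex; eexists; apply: eq_cesaro_cvg (cvA _) => t; exact: frob_corr.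
Qed.

Lemma mean_corrC u v : u \in S -> v \in S -> mean_corr u v = mean_corr v u.
Proof.
move=> uS vS; apply: cesaro_cvg_unique (@mean_corr_cvg u v) _.
by apply: eq_cesaro_cvg (@mean_corr_cvg v u) => t; rewrite corrC.
Qed.

Lemma mean_corr_eq0 u v : mean_corr u v = 0 <-> forall t, q t u v = 0.
Proof.
have H := @mean_corr_cvg u v; split=> [K0|q0].
  by move: H; rewrite K0; exact/recurrence/transition_orth.
apply: cesaro_cvg_unique H _; apply: (@cesaro_cvg _ _ 0 0) => T.
by rewrite big1 => [|t _]; rewrite ?q0 ?expr0n // mulr0 subrr normr0.
Qed.

(* With Y = \sum_i c_i y_i y_i^T, the form is the squared Frobenius norm of
   the projection of Y onto the matrices commuting with U. *)
Lemma mean_corr_psd (I : finType) (c : I -> R) (f : I -> V) :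
  0 <= \sum_i \sum_j c i * c j * mean_corr (f i) (f j).
Proof.
pose Y := \sum_i c i *: (y (f i) *m (y (f i))^T).
have Uorth := transition_orth R S e_sym ereg.
have [A [UA cvA]] := mean_ergodic Uorth Y.
rewrite (_ : \sum_i _ = frob A A); first exact: frob_ge0.
(* [frob A A] becomes [frob Y A], the mean of [frob Y (orbit U t Y)], which expands bilinearly into
   the quadratic form. *)
rewrite -(frob_invariant Uorth UA cvA).
apply: cesaro_cvg_unique (cvA Y).
have cvK : (cesaro (fun t => \sum_i \sum_j c i * c j * q t (f i) (f j) ^+ 2)
    @ \oo --> \sum_i \sum_j c i * c j * mean_corr (f i) (f j))%classic.
  by do 2![apply: cesaro_cvg_sum => ?]; exact/cesaro_cvgZ/mean_corr_cvg.
apply: eq_cesaro_cvg cvK => t.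
rewrite [in RHS]/Y frob_suml; apply: eq_bigr => i _.
have -> : orbit U t Y = \sum_j c j *: orbit U t (y (f j) *m (y (f j))^T).
  rewrite /orbit mulmx_sumr mulmx_suml; apply: eq_bigr => j _.
  by rewrite -scalemxAr -scalemxAl.
rewrite frobC frob_suml mulr_sumr; apply: eq_bigr => j _.
by rewrite frobC frob_corr mulrA.
Qed.

Lemma avg_vertex_mixingE u v : walk_equitable_nbhds e S -> u \in S -> v \in S ->
  avg_vertex_mixing R e k S (enum_rank u) (enum_rank v) =
  k%:R^-1 * (2^-1 * ((u == v)%:R * deg_in R e S u) + 2^-1 * (e u v)%:R +
             mean_corr u v / deg_out R e S u).
Proof.
move=> equit uS vS; rewrite mxE !enum_rankK; apply: (cvg_lim (@Rhausdorff R)).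
apply: (@eq_cesaro_cvg _ (fun t => k%:R^-1 *
    (((u == v)%:R * deg_in R e S u) * (~~ odd t)%:R + (e u v)%:R * (odd t)%:R +
     (deg_out R e S u)^-1 * q t u v ^+ 2))) => [t|].
  by rewrite vertex_mixingE //; congr (_ * (_ + _ + _)); exact: mulrC.
rewrite ![2^-1 * _]mulrC [mean_corr _ _ / _]mulrC.
apply/cesaro_cvgZ/cesaro_cvgD; last exact/cesaro_cvgZ/mean_corr_cvg.
by apply: cesaro_cvgD; apply: cesaro_cvgZ; [exact: cesaro_even|exact: cesaro_odd].
Qed.

Lemma deg_out_neq0 u w : w \in nbhd e u :\: S -> deg_out R e S u != 0.
Proof.
move=> wu; rewrite pnatr_eq0 -lt0n; apply/card_gt0P; exists w.
by move: wu; rewrite !inE andbC.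
Qed.

Lemma degree_gt0 u w : e u w -> k%:R != 0 :> R.
Proof.
move=> uw; rewrite pnatr_eq0 -lt0n -(ereg u); apply/card_gt0P.
by exists w; rewrite inE.
Qed.

(** On the arcs from [u] out of [S] the amplitudes start at zero because [u != v], and by separation
    every later increment is a vanishing Chebyshev value. *)
Lemma corr_separated t u v : u \in S -> v \in S -> u != v ->
  separated e S u v -> q t u v = 0.
Proof.
move=> uS vS uv sep; rewrite corr_amp big1 // => a /andP[/eqP au aS].
have auS : arc_tail a \in S by rewrite au.
suff [] : amp R k S v t a = 0 /\ amp R k S v t.+1 a = 0 by [].
elim: t => [|t [IH IH1]]; first by rewrite amp0 (amp1 _ e_sym) // au (negPf uv).
split=> //; rewrite (ampSS _ e_sym) // IH addr0 (@cheb_separated R V e k S u) ?mulr0 //.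
by rewrite inE aS inE -au arcP.
Qed.

(** The correlation is a nonempty sum of equal amplitudes, so its vanishing kills each of them; then
    all Chebyshev values at [x] vanish, against [cheb_connect]. *)
Lemma corr_connected u v x z : walk_equitable_nbhds e S -> u \in S -> v \in S ->
  x \in nbhd e u :\: S -> z \in nbhd e v :\: S ->
  connect (induced e (~: S)) x z -> ~ forall t, q t u v = 0.
Proof.
move=> equit uS vS xu zv xz q0.
move: (xu); rewrite inE => /andP[xS]; rewrite inE => ux.
have k0 := degree_gt0 ux.
pose a : Defs.arc e := Sub (u, x) ux.
have amp_eq0 t : amp R k S v t a = 0.
  have /eqP := q0 t; rewrite corr_amp (eq_bigr (fun=> amp R k S v t a)); last first.
    move=> b /andP[/eqP bu bS].
    by apply: (@amp_nbhd_constant R V e k S e_sym ereg v t b a equit vS); rewrite ?bu.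
  rewrite sumr_const -mulr_natl card_outer mulf_eq0 (negPf (deg_out_neq0 xu)) /=.
  by move/eqP.
apply: (@cheb_connect R V e k S v x z) => // t.
have chebS s : cheb R e k S v s.+2 x = 0.
  have := amp_eq0 s.+2; rewrite (ampSS _ e_sym) // amp_eq0 addr0 => /eqP.
  by rewrite !mulf_eq0 invr_eq0 pnatr_eq0 (negPf k0) /= => /eqP.
(* Index 1 is zero by definition, and index 0 is minus index 2. *)
case: t => [|[|t]] //; have := chebS 0%N.
rewrite chebSS /adj big1 // mulr0 sub0r => /eqP; rewrite oppr_eq0 => /eqP//.
Qed.

End Limit.

Lemma symmetricmxP (R : fieldType) n (A : 'M[R]_n) :
  reflect (forall i j, A i j = A j i) (A \is symmetricmx).
Proof.
apply: (iffP (is_hermitianmxP _ _ _)); rewrite expr0 scale1r.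
  by move=> symA i j; rewrite {1}symA !mxE.
by move=> symA; apply/matrixP => i j; rewrite !mxE symA.
Qed.

(** * Symmetry and positivity of the marked block *)

Section Main.
Variables (R : realType) (V : finType) (e : rel V) (k : nat) (S : {set V}).
Hypothesis e_sym : symmetric e.
Hypothesis ereg : regular_graph e k.
Hypothesis equit : walk_equitable_nbhds e S.
Local Notation M := (principal_submx S (avg_vertex_mixing R e k S)).
Local Notation K := (mean_corr R e k S).
Local Notation d := (deg_out R e S).

Lemma principal_mixingE (i j : 'I_#|S|) : M i j =
  k%:R^-1 * (2^-1 * ((i == j)%:R * deg_in R e S (enum_val i)) +
    2^-1 * (e (enum_val i) (enum_val j))%:R +
    K (enum_val i) (enum_val j) / d (enum_val i)).
Proof.
by rewrite mxE avg_vertex_mixingE ?enum_valP // (inj_eq enum_val_inj).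
Qed.

(** M_uv - M_vu is K_uv (1/d_u - 1/d_v) / k for distinct [u] and [v], so unequal degrees force K_uv
    = 0, which a connection outside [S] excludes. *)
Lemma symmetric_degree_separating :
  M \is symmetricmx -> degree_separating e (~: S) (induced e (~: S)) S.
Proof.
move=> /symmetricmxP symM u v uS vS duv x z xu zv; apply/negP => xz.
have {}xu : x \in nbhd e u :\: S by move: xu; rewrite !inE andbC.
have {}zv : z \in nbhd e v :\: S by move: zv; rewrite !inE andbC.
have uv : u != v by apply/eqP => uv; apply: duv; rewrite uv.
apply: (corr_connected e_sym ereg equit uS vS xu zv xz).
apply/(@mean_corr_eq0 R V e k S e_sym ereg u v).
have k0 : k%:R != 0 :> R.
  by move: xu; rewrite !inE => /andP[_]; exact: degree_gt0.
have /eqP := symM (enum_rank_in uS u) (enum_rank_in uS v).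
rewrite !principal_mixingE !enum_rankK_in //.
rewrite (inj_in_eq (can_in_inj (enum_rankK_in uS))) // [_ == enum_rank_in _ u]eq_sym.
rewrite (inj_in_eq (can_in_inj (enum_rankK_in uS))) // (negPf uv) (e_sym v u).
rewrite (mean_corrC R e_sym ereg vS uS) !mul0r !mulr0.
rewrite (inj_eq (mulfI (invr_neq0 k0))) (inj_eq (addrI _)) -subr_eq0 -mulrBr.
rewrite mulf_eq0 subr_eq0 (inj_eq invr_inj) => /orP[/eqP//|/eqP dd].
by case: duv; apply/eqP; rewrite -(eqr_nat R); apply/eqP.
Qed.

Lemma mean_corr_degree u v : degree_separating e (~: S) (induced e (~: S)) S ->
  u \in S -> v \in S -> d u != d v -> K u v = 0.
Proof.
move=> sep uS vS duv; apply/(@mean_corr_eq0 R V e k S e_sym ereg u v) => t.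
have uv : u != v by apply: contraNneq duv => ->.
apply: (@corr_separated R V e k S e_sym ereg t u v uS vS uv) => x z xu zv.
by apply: sep xu zv => // /(congr1 (fun m => m%:R : R))/eqP; exact/negP.
Qed.

Lemma degree_separating_psd :
  degree_separating e (~: S) (induced e (~: S)) S -> positive_semidefinite M.
Proof.
move=> sep.
(* Equal degrees split 1/d_u into two inverse square roots; unequal ones make [K u v] zero on both
   sides. *)
have Kd u v : u \in S -> v \in S -> K u v / d u =
    (Num.sqrt (d u))^-1 * (Num.sqrt (d v))^-1 * K u v.
  move=> uS vS; have [duv|duv] := eqVneq (d u) (d v).
    by rewrite -duv -invfM -expr2 sqr_sqrtr // mulrC.
  by rewrite mean_corr_degree // mul0r mulr0.
split.
  apply/symmetricmxP => i j; rewrite !principal_mixingE.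
  rewrite !Kd ?enum_valP // (mean_corrC R e_sym ereg (enum_valP j) (enum_valP i)).
  rewrite (e_sym (enum_val j)) (mulrC (Num.sqrt (d (enum_val j)))^-1) (eq_sym j).
  by case: eqVneq => [->|_] //; rewrite !mul0r.
move=> x.
pose s (i : 'I_#|S|) : V := enum_val i; pose c i := x i 0.
have -> : (x^T *m M *m x) 0 0 = \sum_i \sum_j c i * c j * M i j.
  rewrite -mulmxA mxE; apply: eq_bigr => i _; rewrite !mxE mulr_sumr.
  by apply: eq_bigr => j _; rewrite -mulrA (mulrC (c j)).
have deg_inE i : deg_in R e S (s i) = \sum_j (e (s i) (s j))%:R.
  rewrite /deg_in -sum1_card natr_sum (eq_bigl (fun v => (v \in S) && e (s i) v)).
    rewrite big_mkcondr (big_enum_val (fun v => if e (s i) v then 1 else 0)) /=.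
    by apply: eq_bigr => j _; rewrite /s; case: (e _ _).
  by move=> v; rewrite !inE andbC.
(* The first sum is the form of the signless Laplacian of the graph induced on [S]. Its weight is
   1/2, and ordered pairs count each edge twice, hence [4^-1]. *)
have -> : \sum_i \sum_j c i * c j * M i j =
   k%:R^-1 * (4^-1 * \sum_i \sum_j (e (s i) (s j))%:R * (c i + c j) ^+ 2 +
   \sum_i \sum_j (c i / Num.sqrt (d (s i))) * (c j / Num.sqrt (d (s j))) * K (s i) (s j)).
  have split3 : \sum_i \sum_j (e (s i) (s j))%:R * (c i + c j) ^+ 2 =
      2 * \sum_i (c i ^+ 2 * deg_in R e S (s i)) +
      2 * \sum_i \sum_j c i * c j * (e (s i) (s j))%:R.
    have swap : \sum_i \sum_j (e (s i) (s j))%:R * c j ^+ 2 =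
        \sum_i \sum_j (e (s i) (s j))%:R * c i ^+ 2.
      by rewrite exchange_big; do 2![apply: eq_bigr => ? _]; rewrite e_sym.
    have -> : \sum_i (c i ^+ 2 * deg_in R e S (s i)) =
        \sum_i \sum_j (e (s i) (s j))%:R * c i ^+ 2.
      by apply: eq_bigr => i _; rewrite deg_inE mulr_sumr; apply: eq_bigr => j _; rewrite mulrC.
    rewrite mulr2n mulrDl mul1r -{2}swap !mulr_sumr -!big_split /=.
    apply: eq_bigr => i _; rewrite mulr_sumr -!big_split /=; apply: eq_bigr => j _; ring.
  rewrite split3.
  transitivity (k%:R^-1 * \sum_i \sum_j (
     c i * c j * (2^-1 * ((i == j)%:R * deg_in R e S (s i))) +
     2^-1 * (c i * c j * (e (s i) (s j))%:R) +
     c i / Num.sqrt (d (s i)) * (c j / Num.sqrt (d (s j))) * K (s i) (s j))).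
    rewrite mulr_sumr; apply: eq_bigr => i _; rewrite mulr_sumr; apply: eq_bigr => j _.
    rewrite principal_mixingE Kd ?enum_valP // -/(s i) -/(s j); ring.
  congr (_ * _); under eq_bigr do rewrite !big_split /=.
  rewrite !big_split /=; congr (_ + _); rewrite mulrDr !mulr_sumr; congr (_ + _).
    apply: eq_bigr => i _; rewrite (bigD1 i) //= eqxx big1 => [|j ji]; last first.
      by rewrite eq_sym (negPf ji) mul0r !mulr0.
    rewrite mul1r addr0; by field.
  apply: eq_bigr => i _; rewrite !mulr_sumr; apply: eq_bigr => j _; by field.
rewrite mulr_ge0 ?invr_ge0 // addr_ge0 //; last exact: mean_corr_psd.
rewrite mulr_ge0 ?invr_ge0 //; do 2![apply: sumr_ge0 => ? _].
by rewrite mulr_ge0 ?sqr_ge0.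
Qed.

End Main.

Theorem theorem8p1 (R : realType) (V : finType) (e : rel V) (k : nat)
    (S : {set V}) (Xsimple : simple_graph e) (Xregular : regular_graph e k)
    (Xconnected : connected_graph e) (Snonempty : S != finset.set0)
    (Sequitable : walk_equitable_nbhds e S) :
  let M_SS := principal_submx S (avg_vertex_mixing R e k S) in
  (M_SS \is symmetricmx <-> positive_semidefinite M_SS) /\
  (positive_semidefinite M_SS <->
     degree_separating e (~: S)%SET (induced e (~: S)%SET) S).
Proof.
have [e_sym _] := Xsimple.
have sym_sep := @symmetric_degree_separating R V e k S e_sym Xregular Sequitable.
have sep_psd := @degree_separating_psd R V e k S e_sym Xregular Sequitable.
(* Positive semidefiniteness contains symmetry by definition, so passing through degree separation
   closes the cycle. *)
split; split=> [symM | psdM].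
- exact/sep_psd/sym_sep.
- by case: psdM.
- by case: symM => /sym_sep.
- exact: sep_psd.
Qed.
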